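(* Let $s,t$ be positive integers with $s>t\geq 1$, $\gcd(s,t)=1$ and $s-t$ odd. Then the following are all congruent numbers: (1) $A=st(s^2-t^2)$; (2) $B=st(s^2+t^2)/2$; (3) $C=s^4-t^4$; (4) $D=2(s^4+t^4)$; (5) $E=s^4+t^4+6s^2t^2$; (6) $F=6s^2t^2-s^4-t^4$, provided that $2st>s^2-t^2$.
   Context: A positive rational number $r$ is called a congruent number if there exist positive rational numbers $u,v,w$ with $u^2+v^2=w^2$ and $\frac{1}{2}uv=r$. Congruent numbers are not required to be square-free. *)

(* Defs.v *)
From mathcomp Require Import all_boot all_order all_algebra.

Set Implicit Arguments.
Unset Strict Implicit.
Unset Printing Implicit Defensive.

Import Order.TTheory GRing.Theory Num.Theory.
Local Open Scope ring_scope.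

Definition congruent_number (r : rat) : Prop :=
  0 < r /\
  exists u v w : rat,
    [/\ 0 < u, 0 < v, 0 < w, u ^+ 2 + v ^+ 2 = w ^+ 2 & 1 / 2 * u * v = r].

(* Main.v *)
Require Import Defs.
From mathcomp Require Import all_boot all_order all_algebra.
From mathcomp Require Import ring lra.

Import Order.TTheory GRing.Theory Num.Theory.
Local Open Scope ring_scope.

(** A positive rational [r] is congruent as soon as [x y (x^2 - y^2) = k^2 r]
    for some rationals [x > y > 0] and [k > 0]: the right triangle with legs
    [x^2 - y^2] and [2 x y] has area [x y (x^2 - y^2)], and scaling its sides
    by [1 / k] divides the area by [k^2]. All six numbers come from suitable
    pairs [(x, y)]. Let [a = S^2 - T^2], [b = 2 S T], [c = S^2 + T^2], so that
    [a^2 + b^2 = c^2]. The pairs [(S, T)], [((S + T)^2, (S - T)^2)] and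
    [(S^2, T^2)] give the first three numbers. The last three are [c^2 + a^2],
    [c^2 + b^2] and [b^2 - a^2], and come from the pairs [(c^2, a^2)],
    [(c^2, b^2)] and [(b^2, a^2)] with [k = a b c]: in each pair the
    difference or the sum of the entries is the square of the remaining side. *)

Lemma congruent_number_of_pair (x y k r : rat) :
  0 < y -> y < x -> 0 < k -> x * y * (x ^+ 2 - y ^+ 2) = k ^+ 2 * r ->
  congruent_number r.
Proof.
move=> y0 yx k0 e.
have x0 : 0 < x by exact: lt_trans yx.
have d0 : 0 < x ^+ 2 - y ^+ 2.
  by rewrite subr_sqr mulr_gt0 ?subr_gt0 // addr_gt0.
have k1 : k != 0 by rewrite gt_eqF.
have er : r = x * y * (x ^+ 2 - y ^+ 2) / k ^+ 2.
  by rewrite e mulrC mulKf // expf_neq0.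
split.
  by rewrite er divr_gt0 ?exprn_gt0 // mulr_gt0 // mulr_gt0.
exists ((x ^+ 2 - y ^+ 2) / k), (2 * x * y / k), ((x ^+ 2 + y ^+ 2) / k).
split.
- by rewrite divr_gt0.
- by rewrite divr_gt0 // !mulr_gt0.
- by rewrite divr_gt0 // addr_gt0 // exprn_gt0.
- by field.
- by rewrite er; field.
Qed.

Theorem corollary4p4 (s t : nat) (ht : (1 <= t)%N) (hts : (t < s)%N)
    (hgcd : gcdn s t = 1%N) (hodd : odd (s - t)%N) :
  let S : rat := s%:R in
  let T : rat := t%:R in
  congruent_number (S * T * (S ^+ 2 - T ^+ 2)) /\
  congruent_number (S * T * (S ^+ 2 + T ^+ 2) / 2) /\
  congruent_number (S ^+ 4 - T ^+ 4) /\
  congruent_number (2 * (S ^+ 4 + T ^+ 4)) /\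
  congruent_number (S ^+ 4 + T ^+ 4 + 6 * S ^+ 2 * T ^+ 2) /\
  (S ^+ 2 - T ^+ 2 < 2 * S * T ->
   congruent_number (6 * S ^+ 2 * T ^+ 2 - S ^+ 4 - T ^+ 4)).
Proof.
move=> S T.
have T0 : 0 < T by rewrite ltr0n.
have TS : T < S by rewrite ltr_nat.
move: S T T0 TS => S T T0 TS; clear -T0 TS.
have S0 : 0 < S by exact: lt_trans TS.
have ST0 : 0 < S * T by rewrite mulr_gt0.
have lt_sqr (p q : rat) : 0 < p -> p < q -> p ^+ 2 < q ^+ 2.
  by move=> p0 pq; rewrite ltr_pXn2r // nnegrE ltW // (lt_trans p0).
have T20 : 0 < T ^+ 2 by rewrite exprn_gt0.
have T2S2 : T ^+ 2 < S ^+ 2 by exact: lt_sqr.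
have a0 : 0 < S ^+ 2 - T ^+ 2 by rewrite subr_gt0.
have b0 : 0 < 2 * S * T by rewrite -mulrA mulr_gt0.
have c0 : 0 < S ^+ 2 + T ^+ 2 by rewrite addr_gt0 // exprn_gt0.
have ac : S ^+ 2 - T ^+ 2 < S ^+ 2 + T ^+ 2 by lra.
have bc : 2 * S * T < S ^+ 2 + T ^+ 2.
  have : 0 < (S - T) ^+ 2 by rewrite exprn_gt0 // subr_gt0.
  by rewrite sqrrB; lra.
have abc0 : 0 < (S ^+ 2 - T ^+ 2) * (2 * S * T) * (S ^+ 2 + T ^+ 2).
  by rewrite mulr_gt0 // mulr_gt0.
split; first by apply: (@congruent_number_of_pair S T 1) => //; ring.
split.
  apply: (@congruent_number_of_pair ((S + T) ^+ 2) ((S - T) ^+ 2)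
            (4 * (S ^+ 2 - T ^+ 2))).
  - by rewrite exprn_gt0 // subr_gt0.
  - by apply: lt_sqr; rewrite ?subr_gt0 //; lra.
  - by rewrite mulr_gt0.
  - by field.
split; first by apply: (@congruent_number_of_pair (S ^+ 2) (T ^+ 2) (S * T)) => //; ring.
split.
  apply: (@congruent_number_of_pair ((S ^+ 2 + T ^+ 2) ^+ 2)
            ((S ^+ 2 - T ^+ 2) ^+ 2) _ _ _ _ abc0).
  - by rewrite exprn_gt0.
  - exact: lt_sqr.
  - by ring.
split.
  apply: (@congruent_number_of_pair ((S ^+ 2 + T ^+ 2) ^+ 2)
            ((2 * S * T) ^+ 2) _ _ _ _ abc0).
  - by rewrite exprn_gt0.
  - exact: lt_sqr.
  - by ring.
move=> ab.
apply: (@congruent_number_of_pair ((2 * S * T) ^+ 2)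
          ((S ^+ 2 - T ^+ 2) ^+ 2) _ _ _ _ abc0).
- by rewrite exprn_gt0.
- exact: lt_sqr.
- by ring.
Qed.
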